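(* Let $p\in[1,\infty)$, let $G$ be a countable discrete group and let $H$ be a subgroup of $G$. Then the canonical inclusion $\iota\colon H\hookrightarrow G$ induces an isometric embedding $F^p_\lambda(H)\to F^p_\lambda(G)$; that is, the algebra homomorphism $\mathbb{C}[H]\to\mathbb{C}[G]$ induced by $\iota$ extends to an isometric algebra homomorphism $F^p_\lambda(H)\to F^p_\lambda(G)$.
   Context: For a discrete group $G$ (with counting measure as Haar measure), $\lambda_p\colon \ell^1(G)\to\mathcal{B}(\ell^p(G))$ denotes the (integrated form of the) left regular representation, $\lambda_p(f)\xi=f*\xi$, where $\mathcal{B}(E)$ is the Banach algebra of bounded linear operators on a Banach space $E$ and all spaces are complex. The algebra of $p$-pseudofunctions $F^p_\lambda(G)$ is the Banach algebra obtained as the completion of $\ell^1(G)$ in the norm $\|f\|_{F^p_\lambda(G)}=\|\lambda_p(f)\|_{\mathcal{B}(\ell^p(G))}$; equivalently, it is the norm closure of $\lambda_p(\ell^1(G))$ in $\mathcal{B}(\ell^p(G))$. The complex group algebra $\mathbb{C}[G]\subseteq \ell^1(G)$ (finitely supported functions with convolution) is dense in $F^p_\lambda(G)$. *)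

(* Defs.v *)
From HB Require Import structures.
From mathcomp Require Import all_boot all_order all_algebra finmap.
From mathcomp Require Import all_classical all_reals all_analysis complex.
From mathcomp Require Import ring lra.
From mathcomp Require summability.
Set Implicit Arguments.
Unset Strict Implicit.
Unset Printing Implicit Defensive.
Import Order.TTheory GRing.Theory Num.Theory numFieldNormedType.Exports.
Import Normc.
Local Open Scope classical_set_scope.
Local Open Scope ring_scope.
Local Open Scope complex_scope.

Section fset_sums.
Context (R : realType) (X : choiceType).
Implicit Types (u v : X -> R) (A B : {fset X}).

Lemma le_fset_sum u A B : (forall x, 0 <= u x) -> (A `<=` B)%fset ->
  \sum_(x <- A) u x <= \sum_(x <- B) u x.
Proof.
move=> u0 AB; rewrite [leRHS](bigID (mem A))/= -[X in _ <= X + _]big_filter.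
rewrite [X in _ <= X + _](perm_big A)/=; first by rewrite lerDl sumr_ge0.
apply: uniq_perm; rewrite ?filter_uniq ?fset_uniq// => x.
by rewrite mem_filter; case: (boolP (x \in A)) => //= /(fsubsetP AB).
Qed.

Lemma esum_le_finP u (M : R) : (forall x, 0 <= u x) ->
  (\esum_(x in [set: X]) (u x)%:E <= M%:E)%E <->
  forall A, \sum_(x <- A) u x <= M.
Proof.
move=> u0; split=> [uM A|uM].
  rewrite -lee_fin -sumEFin; apply: le_trans uM; apply: esum_ge.
  exists [set` A]; first by split => //; exact: finite_fset.
  by rewrite fsbig_finite ?set_fsetK//; exact: finite_fset.
apply: ge_ereal_sup => _ [A [finA _] <-].
by rewrite fsbig_finite// sumEFin lee_fin.
Qed.

End fset_sums.

Section powR_sums.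
Context (R : realType) (X : choiceType) (p : R) (p1 : 1 <= p).
Implicit Types (f g : X -> R[i]) (A : {fset X}).

Let p_gt0 : 0 < p. Proof. exact: lt_le_trans p1. Qed.

Lemma normc_ge0 (z : R[i]) : 0 <= normc z.
Proof. by case: z => a b; exact: sqrtr_ge0. Qed.

Lemma powR_convex (t x y : R) : 0 <= t -> t <= 1 -> 0 <= x -> 0 <= y ->
  (t * x + (1 - t) * y) `^ p <= t * x `^ p + (1 - t) * y `^ p.
Proof.
move=> t0 t1 x0 y0.
by apply: (convex_powR p1 (Itv01 t0 t1)) => //; rewrite ?inE/= ?in_itv/= ?andbT.
Qed.

(* `lp_bound f M` says that the l^p norm of f is at most M, through finite
   subsums. *)
Definition lp_bound f (M : R) := forall A, \sum_(x <- A) normc (f x) `^ p <= M `^ p.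

Lemma lp_bound_pt f M x : 0 <= M -> lp_bound f M -> normc (f x) <= M.
Proof.
move=> M0 /(_ [fset x]%fset); rewrite big_seq_fset1 => h.
have := @ge0_ler_powR R p^-1 _ _ _ _ _ h.
rewrite !nnegrE !powR_ge0 invr_ge0 (ltW p_gt0) => /(_ isT isT isT).
by rewrite -!powRrM mulfV ?gt_eqF// !powRr1 ?normc_ge0.
Qed.

Lemma lp_boundD f g a b : 0 <= a -> 0 <= b ->
  lp_bound f a -> lp_bound g b -> lp_bound (fun x => f x + g x) (a + b).
Proof.
rewrite le_eqVlt => /predU1P[<-|a0].
  move=> b0 fa gb; have f0 x : f x = 0.
    apply: eq0_normc; apply/eqP; rewrite eq_le normc_ge0 andbT.
    exact: (lp_bound_pt x (lexx 0) fa).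
  by move=> A; rewrite add0r; under eq_bigr do rewrite f0 add0r; exact: gb.
rewrite le_eqVlt => /predU1P[<-|b0].
  move=> fa gb; have g0 x : g x = 0.
    apply: eq0_normc; apply/eqP; rewrite eq_le normc_ge0 andbT.
    exact: (lp_bound_pt x (lexx 0) gb).
  by move=> A; rewrite addr0; under eq_bigr do rewrite g0 addr0; exact: fa.
move=> fa gb A.
have ab0 : 0 < a + b by rewrite addr_gt0.
pose t := a / (a + b).
have t1E : 1 - t = b / (a + b).
  by rewrite /t; field; rewrite gt_eqF.
have t0 : 0 <= t by rewrite divr_ge0// ltW.
have t1 : t <= 1 by rewrite ler_pdivrMr// mul1r lerDl ltW.
have key x : normc (f x + g x) `^ p <=
   (a + b) `^ p * (t * (normc (f x) / a) `^ p + (1 - t) * (normc (g x) / b) `^ p).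
  apply: (@le_trans _ _ ((a + b) `^ p * (t * (normc (f x) / a) + (1 - t) * (normc (g x) / b)) `^ p)).
    rewrite -powRM ?(ltW ab0)//; last first.
      by rewrite addr_ge0// mulr_ge0 ?subr_ge0 ?divr_ge0 ?normc_ge0// ltW.
    have -> : (a + b) * (t * (normc (f x) / a) + (1 - t) * (normc (g x) / b)) =
       normc (f x) + normc (g x).
      by rewrite t1E /t; field; rewrite !gt_eqF.
    by rewrite ge0_ler_powR ?nnegrE ?addr_ge0 ?normc_ge0 ?(ltW p_gt0)// le_normcD.
  apply: ler_wpM2l; first exact: powR_ge0.
  by apply: powR_convex => //; rewrite divr_ge0 ?normc_ge0// ltW.
have fin h c : 0 < c -> lp_bound h c -> \sum_(x <- A) (normc (h x) / c) `^ p <= 1.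
  move=> c0 hc; under eq_bigr do rewrite powRM ?normc_ge0 ?invr_ge0 ?(ltW c0)//.
  rewrite -mulr_suml -powR_inv1 ?(ltW c0)// -powRrM mulN1r powRN ler_pdivrMr ?powR_gt0//.
  by rewrite mul1r; exact: hc.
apply: le_trans (ler_sum _ (fun x _ => key x)) _.
rewrite -mulr_sumr ler_piMr ?powR_ge0// big_split/= -!mulr_sumr.
rewrite -[leRHS](subrKC t 1) lerD//.
  by rewrite ler_piMr// fin.
by rewrite ler_piMr ?subr_ge0// fin.
Qed.

Lemma lp_boundZ f (c : R[i]) M : 0 <= M -> lp_bound f M ->
  lp_bound (fun x => c * f x) (normc c * M).
Proof.
move=> M0 fM A; under eq_bigr do rewrite normcM powRM ?normc_ge0//.
by rewrite -mulr_sumr powRM ?normc_ge0// ler_wpM2l ?powR_ge0.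
Qed.

End powR_sums.

(* `normc` is the modulus with values in R (the norm of R[i] lands in R[i]). *)
Definition lp_sum (R : realType) (X : choiceType) (p : R) (f : X -> R[i]) : \bar R :=
  \esum_(x in [set: X]) (normc (f x) `^ p)%:E.

(* l^p(X) for the counting measure on X. *)
Record lp (R : realType) (p : R) (p1 : 1 <= p) (X : choiceType) := Lp {
  lp_fun :> X -> R[i];
  lp_finite : (lp_sum p lp_fun < +oo)%E
}.

Section lp_theory.
Context (R : realType) (p : R) (p1 : 1 <= p) (X : choiceType).
Implicit Types f g : X -> R[i].

Let p_gt0 : 0 < p. Proof. exact: lt_le_trans p1. Qed.

HB.instance Definition _ := [isSub for @lp_fun R p p1 X].
HB.instance Definition _ := [Choice of lp p1 X by <:].

Lemma lp_sum_ge0 f : (0 <= lp_sum p f)%E.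
Proof. by apply: esum_ge0 => x _; rewrite lee_fin powR_ge0. Qed.

Lemma lp_sum_leP f (M : R) : (lp_sum p f <= (M `^ p)%:E)%E <-> lp_bound p f M.
Proof. by apply: esum_le_finP => x; exact: powR_ge0. Qed.

Lemma lp_finiteP f : (lp_sum p f < +oo)%E <-> exists2 M : R, 0 <= M & lp_bound p f M.
Proof.
split=> [foo|[M M0 /lp_sum_leP /le_lt_trans->//]]; last exact: ltry.
have ff : lp_sum p f \is a fin_num by rewrite ge0_fin_numE// lp_sum_ge0.
exists (fine (lp_sum p f) `^ p^-1); first exact: powR_ge0.
apply/lp_sum_leP; rewrite -powRrM mulVf ?gt_eqF// powRr1 ?fineK//.
by rewrite fine_ge0// lp_sum_ge0.
Qed.

Lemma lp_submod_closed : GRing.submod_closed [pred f : X -> R[i] | (lp_sum p f < +oo)%E].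
Proof.
split=> [|c f g]; rewrite !inE/=.
  apply/lp_finiteP; exists 0 => // A; rewrite big1 ?powR_ge0// => x _.
  by rewrite normc0 powR0 ?gt_eqF.
move=> /lp_finiteP[a a0 fa] /lp_finiteP[b b0 gb].
apply/lp_finiteP; exists (normc c * a + b).
  by rewrite addr_ge0// mulr_ge0// normc_ge0.
by apply: lp_boundD => //; [rewrite mulr_ge0// normc_ge0|exact: lp_boundZ].
Qed.

HB.instance Definition _ := GRing.SubChoice_isSubLmodule.Build R[i] (X -> R[i])
  [pred f : X -> R[i] | (lp_sum p f < +oo)%E] (lp p1 X) lp_submod_closed.

Definition lp_norm (f : lp p1 X) : R := fine (lp_sum p f) `^ p^-1.

Lemma lp_norm_ge0 (f : lp p1 X) : 0 <= lp_norm f.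
Proof. exact: powR_ge0. Qed.

Lemma lp_norm_bound (f : lp p1 X) : lp_bound p f (lp_norm f).
Proof.
have ff : lp_sum p f \is a fin_num by rewrite ge0_fin_numE ?lp_sum_ge0// lp_finite.
apply/lp_sum_leP; rewrite -powRrM mulVf ?gt_eqF// powRr1 ?fineK//.
by rewrite fine_ge0// lp_sum_ge0.
Qed.

Lemma lp_norm_leP (f : lp p1 X) M : 0 <= M -> lp_norm f <= M <-> lp_bound p f M.
Proof.
move=> M0; split=> [fM A|/lp_sum_leP fM].
  apply: le_trans (lp_norm_bound f A) _.
  by rewrite ge0_ler_powR ?nnegrE ?lp_norm_ge0 ?(ltW p_gt0).
have ff : lp_sum p f \is a fin_num by rewrite ge0_fin_numE ?lp_sum_ge0// lp_finite.
have -> : M = (M `^ p) `^ p^-1 by rewrite -powRrM mulfV ?gt_eqF// powRr1.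
rewrite ge0_ler_powR ?nnegrE ?powR_ge0 ?invr_ge0 ?(ltW p_gt0)//.
  by rewrite fine_ge0// lp_sum_ge0.
by rewrite -lee_fin fineK.
Qed.

Lemma lp_norm_pt (f : lp p1 X) x : normc (f x) <= lp_norm f.
Proof. by apply: (lp_bound_pt p1) => //; [exact: lp_norm_ge0|exact: lp_norm_bound]. Qed.

Lemma lp_addE (f g : lp p1 X) x : (f + g) x = f x + g x. Proof. by []. Qed.
Lemma lp_scaleE (c : R[i]) (f : lp p1 X) x : (c *: f) x = c * f x. Proof. by []. Qed.
Lemma lp_zeroE x : (0 : lp p1 X) x = 0. Proof. by []. Qed.
Lemma lp_oppE (f : lp p1 X) x : (- f) x = - f x. Proof. by []. Qed.
Lemma lp_ext (f g : lp p1 X) : f =1 g -> f = g.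
Proof. by move=> fg; apply/val_inj/funext. Qed.

Lemma lp_normD (f g : lp p1 X) : (lp_norm (f + g))%:C <= (lp_norm f)%:C + (lp_norm g)%:C.
Proof.
rewrite -rmorphD/= lecR; apply/lp_norm_leP; first by rewrite addr_ge0 ?lp_norm_ge0.
by apply: lp_boundD; rewrite ?lp_norm_ge0//; exact: lp_norm_bound.
Qed.

Lemma lp_normZ (c : R[i]) (f : lp p1 X) : (lp_norm (c *: f))%:C = `|c| * (lp_norm f)%:C.
Proof.
have -> : `|c| = (normc c)%:C by case: (c).
rewrite -rmorphM/=; congr (_ %:C).
have le d (g : lp p1 X) : lp_norm (d *: g) <= normc d * lp_norm g.
  apply/lp_norm_leP; first by rewrite mulr_ge0 ?normc_ge0 ?lp_norm_ge0.
  by apply: lp_boundZ => //; [exact: lp_norm_ge0 | exact: lp_norm_bound].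
apply/eqP; rewrite eq_le le/=.
have [->|c0] := eqVneq c 0; first by rewrite normc0 mul0r lp_norm_ge0.
rewrite -ler_pdivlMl; last first.
  by rewrite lt_neqAle normc_ge0 andbT eq_sym; apply: contra c0 => /eqP/eq0_normc->.
by rewrite -normcV -[X in lp_norm X <= _](scalerK c0) le.
Qed.

Lemma lp_norm0_eq0 (f : lp p1 X) : (lp_norm f)%:C = 0 -> f = 0.
Proof.
move=> [f0]; apply: lp_ext => x; apply: eq0_normc; apply/eqP.
by rewrite eq_le normc_ge0 andbT -f0 lp_norm_pt.
Qed.

HB.instance Definition _ := Lmodule_isNormed.Build R[i] (lp p1 X)
  lp_normD lp_normZ lp_norm0_eq0.

Lemma lp_normE (f : lp p1 X) : `|f| = (lp_norm f)%:C. Proof. by []. Qed.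

End lp_theory.

(* Unordered sum: limit of the sums over finite subsets of X. *)
Definition csum (R : realType) (X : choiceType) (f : X -> R[i]) : R[i] :=
  summability.sum (f : X -> R[i]^o).

Section csum_theory.
Context (R : realType) (X : choiceType).
Implicit Types (f g : X -> R[i]) (A : {fset X}).

Definition has_csum f (l : R[i]) := forall e : R, 0 < e ->
  exists A0 : {fset X}, forall A, (A0 `<=` A)%fset ->
    normc (l - \sum_(x <- A) f x) <= e.

Lemma norm_normcE (z : R[i]) : `|z| = (normc z)%:C. Proof. by case: z. Qed.

Lemma normc_sum (A : {fset X}) f : normc (\sum_(x <- A) f x) <= \sum_(x <- A) normc (f x).
Proof.
by rewrite -lecR -norm_normcE rmorph_sum/= (le_trans (ler_norm_sum _ _ _)).
Qed.

Lemma has_csumE f l : has_csum f l -> csum f = l.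
Proof.
move=> fl; have FF := @summability.totally_filter X.
apply: (@cvg_lim R[i]^o) => //; apply/(@cvgrPdist_le _ R[i]^o) => e e0.
have eE : e = (complex.Re e)%:C by rewrite RRe_real// gtr0_real.
rewrite eE; have {}e0 : 0 < complex.Re e by rewrite -ltcR -eE.
have [A0 fA0] := fl _ e0; exists A0 => // A A0A.
rewrite [leLHS]norm_normcE lecR; apply: le_trans (fA0 _ A0A).
by rewrite /summability.partial_sum (big_seq_fsetE _ _ xpredT).
Qed.

Lemma has_csumD f g l m : has_csum f l -> has_csum g m ->
  has_csum (fun x => f x + g x) (l + m).
Proof.
move=> fl gm e e0; have e20 : 0 < e / 2 by rewrite divr_gt0.
have [A fA] := fl _ e20; have [B gB] := gm _ e20.
exists (A `|` B)%fset => D; rewrite fsubUset => /andP[AD BD].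
rewrite big_split/= opprD addrACA (splitr e).
by rewrite (le_trans (le_normcD _ _))// lerD ?fA ?gB.
Qed.

Lemma has_csumZ f l c : has_csum f l -> has_csum (fun x => c * f x) (c * l).
Proof.
move=> fl e e0.
have c0 : 0 < normc c + 1 by rewrite ltr_wpDl ?normc_ge0.
have [A fA] := fl _ (divr_gt0 e0 c0).
exists A => D AD; rewrite -mulr_sumr -mulrBr normcM.
have h := fA _ AD; rewrite ler_pdivlMr// in h.
by apply: le_trans h; rewrite mulrC ler_wpM2l ?normc_ge0// lerDl.
Qed.

Lemma has_csum_fin f A : (forall x, x \notin A -> f x = 0) ->
  has_csum f (\sum_(x <- A) f x).
Proof.
move=> f0 e e0; exists A => D AD.
suff -> : \sum_(x <- D) f x = \sum_(x <- A) f x by rewrite subrr normc0 ltW.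
rewrite (bigID (mem A))/= [X in _ + X]big1 ?addr0; last by move=> x /f0.
rewrite -big_filter; apply: perm_big; apply: uniq_perm; rewrite ?filter_uniq ?fset_uniq// => x.
by rewrite mem_filter; case: (boolP (x \in A)) => //= /(fsubsetP AD).
Qed.

Lemma has_csum_le f l M : has_csum f l ->
  (forall A, \sum_(x <- A) normc (f x) <= M) -> normc l <= M.
Proof.
move=> fl fM; apply/ler_addgt0Pl => e /fl[A /(_ A (fsubset_refl A)) fA].
rewrite -(subrK (\sum_(x <- A) f x) l) (le_trans (le_normcD _ _))// lerD//.
exact: le_trans (normc_sum _ _) (fM A).
Qed.

Lemma has_csum_pos (u : X -> R) M : (forall x, 0 <= u x) ->
  (forall A, \sum_(x <- A) u x <= M) -> exists l, has_csum (fun x => (u x)%:C) l.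
Proof.
move=> u0 uM; pose S := [set \sum_(x <- A) u x | A in [set: {fset X}]].
have supS : has_sup S.
  split; first by exists (\sum_(x <- fset0) u x); exists fset0.
  by exists M => _ [A _ <-].
exists (sup S)%:C => e e0.
have [_ [A _ <-] Ae] := sup_adherent e0 supS.
exists A => D AD.
rewrite -rmorph_sum -rmorphB -lecR -norm_normcE ger0_norm; last first.
  rewrite ler0c subr_ge0; apply: sup_upper_bound => //.
  by exists D.
rewrite lecR lerBlDr -lerBlDl (le_trans (ltW Ae))//.
exact: le_fset_sum.
Qed.

Lemma has_csum_abs f M : (forall A, \sum_(x <- A) normc (f x) <= M) ->
  exists l, has_csum f l.
Proof.
move=> fM.
have Rele x : `|complex.Re (f x)| <= normc (f x) by rewrite -lecR -norm_normcE normc_ge_Re.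
have Imle x : `|complex.Im (f x)| <= normc (f x).
  case: (f x) => a b /=; rewrite -sqrtr_sqr ler_wsqrtr// lerDr sqr_ge0//.
have real (u : X -> R) : (forall x, `|u x| <= normc (f x)) ->
    exists l, has_csum (fun x => (u x)%:C) l.
  move=> uf.
  have [l1 l1P] : exists l, has_csum (fun x => (u x + normc (f x))%:C) l.
    apply: (@has_csum_pos _ (M + M)) => [x|A].
      by have := uf x; rewrite ler_norml lerNl => /andP[? _]; rewrite -lerBlDr sub0r lerNl.
    rewrite big_split/= lerD// (le_trans _ (fM A))// ler_sum// => x _.
    exact: le_trans (ler_norm _) (uf x).
  have [l2 l2P] : exists l, has_csum (fun x => (normc (f x))%:C) l.
    by apply: (@has_csum_pos _ M) => [x|//]; exact: normc_ge0.
  exists (l1 + -1 * l2); have := has_csumD l1P (has_csumZ (-1) l2P).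
  congr has_csum; apply/funext => x.
  by rewrite rmorphD/= mulN1r addrK.
have [a aP] := real _ Rele; have [b bP] := real _ Imle.
exists (a + 'i * b); have := has_csumD aP (has_csumZ 'i bP).
by congr has_csum; apply/funext => x; rewrite -complexE.
Qed.

Lemma csumP f M : (forall A, \sum_(x <- A) normc (f x) <= M) -> has_csum f (csum f).
Proof. by move=> /has_csum_abs[l fl]; rewrite (has_csumE fl). Qed.

End csum_theory.

Definition bounded_linear (R : realType) (E : normedModType R[i]) (T : E -> E) :=
  linear T /\ exists M : R[i], forall x, `|T x| <= M * `|x|.

(* B(E). *)
Record bop (R : realType) (E : normedModType R[i]) := Bop {
  bop_fun :> E -> E;
  bop_bounded : `[< bounded_linear bop_fun >]
}.

Section bop_theory.
Context (R : realType) (E : normedModType R[i]).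
Implicit Types (S T : bop E) (x y : E).

HB.instance Definition _ := [isSub for @bop_fun R E].
HB.instance Definition _ := [Choice of bop E by <:].

Lemma bop_ext S T : S =1 T -> S = T.
Proof. by move=> ST; apply/val_inj/funext. Qed.

Lemma Re_normK x : (complex.Re `|x|)%:C = `|x|.
Proof. by rewrite RRe_real// ger0_real. Qed.

Lemma Re_norm_ge0 x : 0 <= complex.Re `|x|.
Proof. by rewrite -ler0c Re_normK. Qed.

Lemma bounded_linearP (T : E -> E) : bounded_linear T ->
  exists2 M : R, 0 <= M & forall x, `|T x| <= M%:C * `|x|.
Proof.
move=> [_ [M TM]]; exists `|complex.Re M| => // x.
have := TM x; have := Re_norm_ge0 x; have := normr_ge0 (T x).
rewrite -(Re_normK x); set r := complex.Re `|x|; move: (`|T x|) => z z0 r0 zM.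
apply: (le_trans zM).
have [->|rN0] := eqVneq r 0; first by rewrite !mulr0.
have Mr0 := le_trans z0 zM; case: M {TM} zM Mr0 => a b _ /ger0_Im/=.
rewrite mulr0 add0r => /eqP; rewrite mulf_eq0 (negbTE rN0) orbF => /eqP->.
by rewrite complexr0 -!rmorphM lecR ler_wpM2r ?ler_norm.
Qed.

Lemma bop_submod_closed : GRing.submod_closed [pred T : E -> E | `[< bounded_linear T >]].
Proof.
split=> [|c S T]; rewrite !inE/=.
  split; first by move=> a x y; rewrite scaler0 addr0.
  by exists 0 => x; rewrite normr0 mul0r.
move=> Sb Tb; split.
  move=> a x y; rewrite -[LHS]/(c *: S _ + T _) (Sb.1 a x y) (Tb.1 a x y).
  rewrite -[RHS]/(a *: (c *: S x + T x) + (c *: S y + T y)).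
  by rewrite !scalerDr !scalerA (mulrC c a) addrACA.
have [M M0 SM] := bounded_linearP Sb; have [N N0 TN] := bounded_linearP Tb.
exists (`|c| * M%:C + N%:C) => x /=; rewrite mulrDl (le_trans (ler_normD _ _))//.
by rewrite lerD// normrZ -mulrA ler_wpM2l.
Qed.

HB.instance Definition _ := GRing.SubChoice_isSubLmodule.Build R[i] (E -> E)
  [pred T : E -> E | `[< bounded_linear T >]] (bop E) bop_submod_closed.

Lemma bop_addE S T x : (S + T) x = S x + T x. Proof. by []. Qed.
Lemma bop_oppE T x : (- T) x = - T x. Proof. by []. Qed.
Lemma bop_zeroE x : (0 : bop E) x = 0. Proof. by []. Qed.
Lemma bop_scaleE c T x : (c *: T) x = c *: T x. Proof. by []. Qed.

Lemma bopP T : bounded_linear T. Proof. exact/asboolP/bop_bounded. Qed.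

Lemma bop_linear T : linear T. Proof. exact: (bopP T).1. Qed.

HB.instance Definition _ T := GRing.isLinear.Build R[i] E E *:%R T (bop_linear T).

Lemma bounded_linear_id : `[< bounded_linear (@idfun E) >].
Proof. by apply/asboolP; split=> //; exists 1 => x; rewrite mul1r. Qed.

Lemma bounded_linear_comp S T : `[< bounded_linear (S \o T) >].
Proof.
apply/asboolP; split; first by move=> a x y /=; rewrite !linearP.
have [M M0 SM] := bounded_linearP (bopP S).
have [N N0 TN] := bounded_linearP (bopP T).
exists (M%:C * N%:C) => x /=; rewrite (le_trans (SM _))// -mulrA ler_wpM2l//.
by rewrite ler0c.
Qed.

Definition bop_one : bop E := Bop bounded_linear_id.
Definition bop_mul S T : bop E := Bop (bounded_linear_comp S T).

Let mulA : associative bop_mul. Proof. by move=> S T U; exact: bop_ext. Qed.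
Let mul1 : left_id bop_one bop_mul. Proof. by move=> S; exact: bop_ext. Qed.
Let mulid : right_id bop_one bop_mul. Proof. by move=> S; exact: bop_ext. Qed.
Let mulDl : left_distributive bop_mul +%R.
Proof. by move=> S T U; exact: bop_ext. Qed.
Let mulDr : right_distributive bop_mul +%R.
Proof. by move=> S T U; apply: bop_ext => x /=; rewrite linearD. Qed.

HB.instance Definition _ := GRing.Zmodule_isPzRing.Build (bop E)
  mulA mul1 mulid mulDl mulDr.

Lemma bop_oneE x : (1 : bop E) x = x. Proof. by []. Qed.
Lemma bop_mulE S T x : (S * T) x = S (T x). Proof. by []. Qed.

Lemma bop_scalerAl c S T : c *: (S * T) = (c *: S) * T.
Proof. exact: bop_ext. Qed.

Lemma bop_scalerAr c S T : c *: (S * T) = S * (c *: T).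
Proof. by apply: bop_ext => x; rewrite bop_scaleE !bop_mulE bop_scaleE linearZ. Qed.

(* The operator norm; the instance below casts it to R[i], as the norm of a
   normedModType over R[i] takes its values in R[i]. *)
Definition bop_norm T : R := sup [set complex.Re `|T x| | x in [set x | `|x| <= 1]].

Lemma bop_norm_has_sup T :
  has_sup [set complex.Re `|T x| | x in [set x | `|x| <= 1]].
Proof.
split; first by exists (complex.Re `|T 0|); exists 0 => //=; rewrite normr0.
have [M M0 TM] := bounded_linearP (bopP T).
exists M => _ [x /= x1 <-]; rewrite -lecR Re_normK (le_trans (TM x))//.
by rewrite ler_piMr// ler0c.
Qed.

Lemma bop_norm_ge0 T : 0 <= bop_norm T.
Proof.
apply: (sup_upper_bound (bop_norm_has_sup T)).
by exists 0; rewrite /= ?normr0// linear0 normr0.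
Qed.

Lemma bop_norm_ub T x : `|T x| <= (bop_norm T)%:C * `|x|.
Proof.
have [->|x0] := eqVneq x 0; first by rewrite linear0 !normr0 mulr0.
have nx0 : `|x| != 0 by rewrite normr_eq0.
rewrite -ler_pdivrMr ?normr_gt0//.
have -> : `|T x| / `|x| = `|T (`|x|^-1 *: x)|.
  by rewrite linearZ/= normrZ normfV normr_id mulrC.
rewrite -Re_normK lecR; apply: (sup_upper_bound (bop_norm_has_sup T)).
by exists (`|x|^-1 *: x) => //=; rewrite normrZ normfV normr_id mulVf.
Qed.

Lemma bop_norm_le T (M : R) : 0 <= M ->
  (forall x, `|T x| <= M%:C * `|x|) -> bop_norm T <= M.
Proof.
move=> M0 TM; apply: ge_sup; first exact: (bop_norm_has_sup T).1.
move=> _ [x /= x1 <-]; rewrite -lecR Re_normK (le_trans (TM x))//.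
by rewrite ler_piMr// ler0c.
Qed.

Lemma bop_normD S T : (bop_norm (S + T))%:C <= (bop_norm S)%:C + (bop_norm T)%:C.
Proof.
rewrite -rmorphD lecR; apply: bop_norm_le; first by rewrite addr_ge0 ?bop_norm_ge0.
move=> x; rewrite rmorphD mulrDl (le_trans (ler_normD _ _))//.
by rewrite lerD// bop_norm_ub.
Qed.

Lemma bop_normZ c T : (bop_norm (c *: T))%:C = `|c| * (bop_norm T)%:C.
Proof.
have -> : `|c| = (normc c)%:C by case: (c).
have le d S : bop_norm (d *: S) <= normc d * bop_norm S.
  apply: bop_norm_le; first by rewrite mulr_ge0 ?normc_ge0 ?bop_norm_ge0.
  move=> x; rewrite normrZ rmorphM norm_normcE -mulrA ler_wpM2l ?ler0c ?normc_ge0//.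
  exact: bop_norm_ub.
rewrite -rmorphM; congr (_ %:C); apply/eqP; rewrite eq_le le/=.
have [->|c0] := eqVneq c 0; first by rewrite normc0 mul0r bop_norm_ge0.
rewrite -ler_pdivlMl; last first.
  by rewrite lt_neqAle normc_ge0 andbT eq_sym; apply: contra c0 => /eqP/eq0_normc->.
by rewrite -normcV -[X in bop_norm X <= _](scalerK c0) le.
Qed.

Lemma bop_norm0_eq0 T : (bop_norm T)%:C = 0 -> T = 0.
Proof.
move=> T0; apply: bop_ext => x; apply/eqP; rewrite -normr_le0.
by rewrite (le_trans (bop_norm_ub T x))// T0 mul0r.
Qed.

HB.instance Definition _ := Lmodule_isNormed.Build R[i] (bop E)
  bop_normD bop_normZ bop_norm0_eq0.

Lemma bop_normE T : `|T| = (bop_norm T)%:C. Proof. by []. Qed.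

Lemma bop_normr_ub T x : `|T x| <= `|T| * `|x|.
Proof. exact: bop_norm_ub. Qed.

Lemma bop_normM S T : `|S * T| <= `|S| * `|T|.
Proof.
rewrite !bop_normE -rmorphM lecR; apply: bop_norm_le.
  by rewrite mulr_ge0 ?bop_norm_ge0.
move=> x; rewrite rmorphM (le_trans (bop_norm_ub S _))// -mulrA.
by rewrite ler_wpM2l ?ler0c ?bop_norm_ge0// bop_norm_ub.
Qed.

Lemma bop_ler_normD S T : bop_norm (S + T) <= bop_norm S + bop_norm T.
Proof. by rewrite -lecR rmorphD; exact: bop_normD. Qed.

Lemma bop_ler_normM S T : bop_norm (S * T) <= bop_norm S * bop_norm T.
Proof. by rewrite -lecR rmorphM; exact: bop_normM. Qed.

Lemma bop_normN T : bop_norm (- T) = bop_norm T.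
Proof. by apply: complexI; rewrite -!bop_normE normrN. Qed.

Lemma bop_norm_mulB S T U V (d : R) : 0 <= d ->
  bop_norm (S - U) <= d -> bop_norm (T - V) <= d ->
  bop_norm (S * T - U * V) <= d * bop_norm T + (bop_norm S + d) * d.
Proof.
move=> d0 SU TV.
have -> : S * T - U * V = (S - U) * T + U * (T - V).
  by rewrite mulrBl mulrBr addrA subrK.
have UK : bop_norm U <= bop_norm S + d.
  have UE : U = S - (S - U) by rewrite opprB addrC subrK.
  rewrite [in leLHS]UE (le_trans (bop_ler_normD S _))// lerD//.
  by rewrite bop_normN.
apply: (le_trans (bop_ler_normD ((S - U) * T) _)); apply: lerD.
  by apply: (le_trans (bop_ler_normM _ _)); rewrite ler_wpM2r ?bop_norm_ge0.
by apply: (le_trans (bop_ler_normM _ _)); rewrite ler_pM ?bop_norm_ge0.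
Qed.

End bop_theory.

Notation l1 R G := (@lp R 1 (lexx 1) G).

Section lp_bound_limit.
Context (R : realType) (X : choiceType) (p : R) (p1 : 1 <= p).
Implicit Types (u v : X -> R[i]) (A : {fset X}).

Let p_gt0 : 0 < p. Proof. exact: lt_le_trans p1. Qed.

Lemma le_lp_bound u (M N : R) : 0 <= M -> M <= N -> lp_bound p u M -> lp_bound p u N.
Proof.
move=> M0 MN uM A; apply: le_trans (uM A) _.
by rewrite ge0_ler_powR ?nnegrE ?(ltW p_gt0)// (le_trans M0).
Qed.

Lemma lp_bound_lim u K : 0 <= K ->
  (forall A (e : R), 0 < e -> exists2 v, lp_bound p v K &
     forall x, x \in A -> normc (u x - v x) <= e) -> lp_bound p u K.
Proof.
move=> K0 uK A; set S := \sum_(x <- A) _.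
have S0 : 0 <= S by apply: sumr_ge0 => x _; exact: powR_ge0.
suff : S `^ p^-1 <= K.
  move=> /(@ge0_ler_powR _ p); rewrite !nnegrE powR_ge0 (ltW p_gt0) => /(_ isT isT K0).
  by rewrite -powRrM mulVf ?gt_eqF// powRr1.
apply/ler_addgt0Pl => e e0; pose n := (size (enum_fset A)).+1%:R : R.
have n0 : 0 < n by rewrite ltr0n.
have n1 : 1 <= n by rewrite ler1n.
have [v vK uv] := uK A _ (divr_gt0 e0 n0).
pose w x := if x \in A then u x - v x else 0.
have we : lp_bound p w e.
  move=> B; apply: (@le_trans _ _ (\sum_(x <- B | x \in A) (e / n) `^ p)).
    rewrite [leRHS]big_mkcond/= ler_sum// => x _; rewrite /w.
    case: ifPn => xA; last by rewrite normc0 powR0 ?gt_eqF.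
    rewrite ge0_ler_powR ?nnegrE ?normc_ge0 ?(ltW p_gt0) ?uv//.
    by rewrite divr_ge0// ltW.
  rewrite big_const_seq iter_addr_0 -mulr_natr.
  rewrite powRM ?(ltW e0) ?invr_ge0 ?(ltW n0)// -mulrA ler_piMr ?powR_ge0//.
  rewrite -powR_inv1 ?(ltW n0)// -powRrM mulN1r powRN mulrC ler_pdivrMr ?powR_gt0//.
  rewrite mul1r (@le_trans _ _ n)//.
    rewrite ler_nat -size_filter leqW//; apply: uniq_leq_size.
      by rewrite filter_uniq// fset_uniq.
    by move=> x; rewrite mem_filter => /andP[].
  by rewrite -[leLHS](powRr1 (ltW n0)) ler_powR.
have vw := lp_boundD p1 K0 (ltW e0) vK we.
have Ke0 : 0 <= K + e by rewrite addr_ge0// ltW.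
have SKe : S <= (K + e) `^ p.
  apply: le_trans (vw A); rewrite /S le_eqVlt; apply/orP; left; apply/eqP.
  by apply: eq_big_seq => x xA; rewrite /w xA addrC subrK.
have := @ge0_ler_powR R p^-1 _ _ _ _ _ SKe.
rewrite !nnegrE powR_ge0 S0 invr_ge0 (ltW p_gt0) => /(_ isT isT isT).
by rewrite -powRrM mulfV ?gt_eqF// powRr1// addrC.
Qed.

End lp_bound_limit.

Section left_regular.
Context (R : realType) (p : R) (p1 : 1 <= p) (G : groupType).
Implicit Types (f : l1 R G) (xi : lp p1 G) (A D : {fset G}).

Definition convol (f g : G -> R[i]) : G -> R[i] :=
  fun x => csum (fun h : G => f h * g (h^-1 * x)%g).

Lemma l1_sum_le f A : \sum_(h <- A) normc (f h) <= lp_norm f.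
Proof.
have := lp_norm_bound f A; rewrite powRr1 ?lp_norm_ge0//.
by under eq_bigr do rewrite powRr1 ?normc_ge0//.
Qed.

Lemma convol_sum_le f xi x A :
  \sum_(h <- A) normc (f h * xi (h^-1 * x)%g) <= lp_norm f * lp_norm xi.
Proof.
apply: (@le_trans _ _ (\sum_(h <- A) normc (f h) * lp_norm xi)).
  by apply: ler_sum => h _; rewrite normcM ler_wpM2l ?normc_ge0 ?lp_norm_pt.
by rewrite -mulr_suml ler_wpM2r ?lp_norm_ge0 ?l1_sum_le.
Qed.

Lemma convolP f xi x : has_csum (fun h => f h * xi (h^-1 * x)%g) (convol f xi x).
Proof. exact: csumP (convol_sum_le f xi x). Qed.

Lemma lp_bound_translate xi (h : G) : lp_bound p (fun x => xi (h^-1 * x)%g) (lp_norm xi).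
Proof.
move=> A; have inj : injective (fun x : G => h^-1 * x)%g by exact: mulgI.
apply: le_trans (lp_norm_bound xi [fset (h^-1 * x)%g | x in A]%fset).
by rewrite big_imfset//= => x y _ _; exact: inj.
Qed.

Lemma convol_bound f xi : lp_bound p (convol f xi) (lp_norm f * lp_norm xi).
Proof.
have K0 : 0 <= lp_norm f * lp_norm xi by rewrite mulr_ge0 ?lp_norm_ge0.
apply: lp_bound_lim => // A e e0.
have [D DP] : exists D0, forall x, x \in A -> forall D, (D0 `<=` D)%fset ->
    normc (convol f xi x - \sum_(h <- D) f h * xi (h^-1 * x)%g) <= e.
  suff [D0 D0P] : exists D0, forall x, x \in enum_fset A -> forall D, (D0 `<=` D)%fset ->
      normc (convol f xi x - \sum_(h <- D) f h * xi (h^-1 * x)%g) <= e by exists D0.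
  elim: (enum_fset A) => [|a s [D0 IH]]; first by exists fset0.
  have [D1 D1P] := convolP f xi a e0.
  exists (D0 `|` D1)%fset => x; rewrite inE => /predU1P[->|xs] D.
    by rewrite fsubUset => /andP[_]; exact: D1P.
  by rewrite fsubUset => /andP[+ _]; exact: IH.
exists (fun x => \sum_(h <- D) f h * xi (h^-1 * x)%g); last first.
  by move=> x xA; apply: DP.
apply: (@le_lp_bound _ _ _ p1 _ (\sum_(h <- D) normc (f h) * lp_norm xi)).
- by apply: sumr_ge0 => h _; rewrite mulr_ge0 ?normc_ge0 ?lp_norm_ge0.
- by rewrite -mulr_suml ler_wpM2r ?lp_norm_ge0 ?l1_sum_le.
elim: (enum_fset D) => [|h s IH].
  move=> B; rewrite big1 ?powR_ge0// => x _.
  by rewrite big_nil normc0 powR0// gt_eqF// (lt_le_trans _ p1).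
rewrite big_cons; under [X in lp_bound _ X]funext do rewrite big_cons.
apply: lp_boundD => //; first by rewrite mulr_ge0 ?normc_ge0 ?lp_norm_ge0.
  by apply: sumr_ge0 => i _; rewrite mulr_ge0 ?normc_ge0 ?lp_norm_ge0.
by apply: lp_boundZ; rewrite ?lp_norm_ge0//; exact: lp_bound_translate.
Qed.

Lemma convol_finite f xi : (lp_sum p (convol f xi) < +oo)%E.
Proof.
apply/(lp_finiteP p1); exists (lp_norm f * lp_norm xi); last exact: convol_bound.
by rewrite mulr_ge0 ?lp_norm_ge0.
Qed.

Definition lreg_fun f xi : lp p1 G := Lp p1 (convol_finite f xi).

Lemma lreg_fun_norm f xi : `|lreg_fun f xi| <= `|f| * `|xi|.
Proof.
rewrite !lp_normE -rmorphM lecR; apply/lp_norm_leP; last exact: convol_bound.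
by rewrite mulr_ge0 ?lp_norm_ge0.
Qed.

Lemma lreg_bounded f : `[< bounded_linear (lreg_fun f) >].
Proof.
apply/asboolP; split; last by exists `|f| => xi; exact: lreg_fun_norm.
move=> a xi eta; apply: lp_ext => x; apply: has_csumE.
have := has_csumD (has_csumZ a (convolP f xi x)) (convolP f eta x).
by congr has_csum; apply/funext => h; rewrite lp_addE lp_scaleE mulrDr mulrCA.
Qed.

(* The integrated form of the left regular representation on l^p(G). *)
Definition lreg f : bop (lp p1 G) := Bop (lreg_bounded f).

Lemma lreg_norm f : `|lreg f| <= `|f|.
Proof.
rewrite bop_normE lp_normE lecR; apply: bop_norm_le; first exact: lp_norm_ge0.
by move=> xi; exact: lreg_fun_norm.
Qed.

Lemma lreg_linear : linear lreg.
Proof.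
move=> a f g; apply: bop_ext => xi; apply: lp_ext => x; apply: has_csumE.
have := has_csumD (has_csumZ a (convolP f xi x)) (convolP g xi x).
by congr has_csum; apply/funext => h; rewrite lp_addE lp_scaleE mulrDl mulrA.
Qed.

HB.instance Definition _ :=
  GRing.isLinear.Build R[i] (l1 R G) (bop (lp p1 G)) *:%R lreg lreg_linear.

End left_regular.

Section group_algebra.
Context (R : realType) (G : groupType).
Implicit Types (f : {fsfun G -> R[i] with 0}).

Lemma fsfun_l1_finite f : (lp_sum 1 f < +oo)%E.
Proof.
apply/(lp_finiteP (lexx 1)); exists (\sum_(h <- finsupp f) normc (f h)).
  by apply: sumr_ge0 => h _; exact: normc_ge0.
move=> A; rewrite powRr1; last by apply: sumr_ge0 => h _; exact: normc_ge0.
under eq_bigr do rewrite powRr1 ?normc_ge0//.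
rewrite (bigID (mem (finsupp f)))/= [X in _ + X]big1 ?addr0; last first.
  by move=> h hf; rewrite fsfun_dflt// normc0.
rewrite [leRHS](bigID (mem A))/= -[leLHS]addr0 lerD//; last first.
  by apply: sumr_ge0 => h _; exact: normc_ge0.
rewrite -[leLHS]big_filter -[leRHS]big_filter le_eqVlt; apply/orP; left; apply/eqP.
apply: perm_big; apply: uniq_perm; rewrite ?filter_uniq ?fset_uniq// => x.
by rewrite !mem_filter andbC.
Qed.

Definition l1_of_fsfun f : l1 R G := Lp (lexx 1) (fsfun_l1_finite f).

Definition l1_delta (a : G) : l1 R G := l1_of_fsfun [fsfun [fsfun] with a |-> 1].

Lemma l1_deltaE a x : l1_delta a x = (x == a)%:R.
Proof. by rewrite /= fsfun_withE fsfunE; case: eqP. Qed.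

Lemma l1_approx (u : l1 R G) (e : R) : 0 < e ->
  exists A : {fset G}, lp_norm (u - \sum_(a <- A) u a *: l1_delta a) <= e.
Proof.
move=> e0.
have [A Ae] : exists A : {fset G}, lp_norm u - e < \sum_(a <- A) normc (u a).
  apply: contrapT => /forallNP Ae.
  have {}Ae (A : {fset G}) : \sum_(a <- A) normc (u a) <= lp_norm u - e.
    by have /negP := Ae A; rewrite -leNgt.
  have ue0 : 0 <= lp_norm u - e by rewrite (le_trans _ (Ae fset0))// big_seq_fset0.
  have : lp_norm u <= lp_norm u - e.
    apply/lp_norm_leP => // A; rewrite powRr1//.
    by under eq_bigr do rewrite powRr1 ?normc_ge0//.
  by move=> h; lra.
exists A; set v := u - _.
have vE x : v x = if x \in A then 0 else u x.
  rewrite /v lp_addE lp_oppE.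
  have -> : (\sum_(a <- A) u a *: l1_delta a) x = \sum_(a <- A) u a * (x == a)%:R.
    elim/big_rec2: _ => [//|a y w _ wy].
    by rewrite lp_addE lp_scaleE l1_deltaE wy.
  case: ifPn => xA; last first.
    rewrite big_seq big1 ?subr0// => a aA.
    by case: eqP xA => [->|_ _]; rewrite ?aA// mulr0.
  rewrite (bigD1_seq x)//= eqxx mulr1 big1 ?addr0 ?subrr// => a /negbTE ax.
  by rewrite eq_sym ax mulr0.
apply/lp_norm_leP; first exact: ltW.
move=> B; rewrite powRr1 ?(ltW e0)//.
under eq_bigr do rewrite powRr1 ?normc_ge0// vE.
have AB := l1_sum_le u (A `|` B)%fset.
suff h : \sum_(a <- A) normc (u a) + \sum_(x <- B) normc (if x \in A then 0 else u x)
    <= \sum_(a <- (A `|` B)%fset) normc (u a) by lra.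
rewrite [leRHS](bigID (mem A))/= lerD//.
  rewrite -[leRHS]big_filter le_eqVlt; apply/orP; left; apply/eqP.
  apply: perm_big; apply: uniq_perm; rewrite ?filter_uniq ?fset_uniq// => x.
  by rewrite !mem_filter in_fsetU; case: (x \in A).
rewrite (bigID (mem A))/= big1 ?add0r; last by move=> x ->; rewrite normc0.
under eq_bigr => x /negbTE xA do rewrite xA.
rewrite -[leRHS]big_filter -[leLHS]big_filter le_eqVlt; apply/orP; left; apply/eqP.
apply: perm_big; apply: uniq_perm; rewrite ?filter_uniq ?fset_uniq// => x.
by rewrite !mem_filter in_fsetU; case: (x \in A).
Qed.

End group_algebra.

Section translations.
Context (R : realType) (p : R) (p1 : 1 <= p) (G : groupType).

Lemma lreg_deltaE (a : G) (xi : lp p1 G) x :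
  lreg p1 (l1_delta R a) xi x = xi (a^-1 * x)%g.
Proof.
apply: has_csumE.
have : has_csum (fun h => l1_delta R a h * xi (h^-1 * x)%g)
    (\sum_(h <- [fset a]%fset) l1_delta R a h * xi (h^-1 * x)%g).
  apply: has_csum_fin => h; rewrite in_fset1 => /negbTE ha.
  by rewrite l1_deltaE ha mul0r.
by rewrite big_seq_fset1 l1_deltaE eqxx mul1r.
Qed.

Lemma lreg_delta1 : lreg p1 (l1_delta R 1%g) = 1 :> bop (lp p1 G).
Proof.
by apply: bop_ext => xi; apply: lp_ext => x; rewrite lreg_deltaE bop_oneE invg1 mul1g.
Qed.

Lemma lreg_deltaM (a b : G) :
  lreg p1 (l1_delta R a) * lreg p1 (l1_delta R b) = lreg p1 (l1_delta R (a * b)%g).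
Proof.
apply: bop_ext => xi; apply: lp_ext => x.
by rewrite bop_mulE !lreg_deltaE invgM mulgA.
Qed.

Definition lreg_closure : set (bop (lp p1 G)) :=
  closure (range (@lreg R p p1 G)).

Lemma lreg_closureP (T : bop (lp p1 G)) : lreg_closure T <->
  forall e : R, 0 < e -> exists f : l1 R G, bop_norm (T - lreg p1 f) <= e.
Proof.
split=> [TF e e0|TF B /nbhs_ballP[e /= e0 eB]].
  have : nbhs T (ball T e%:C) by apply: nbhsx_ballx; rewrite ltcR.
  move=> /TF[_ [[f _ <-]]]; rewrite -ball_normE/= bop_normE ltcR => /ltW Tf.
  by exists f.
have eE : e = (complex.Re e)%:C by rewrite RRe_real// gtr0_real.
have re0 : 0 < complex.Re e by rewrite -ltcR -eE.
have [f Tf] := TF _ (divr_gt0 re0 (ltr0Sn R 1)).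
exists (lreg p1 f); split; first by exists f.
apply: eB; rewrite -ball_normE/= bop_normE eE ltcR (le_lt_trans Tf)//.
by rewrite ltr_pdivrMr// ltr_pMr// ltr1n.
Qed.

Lemma lreg_closure_lreg f : lreg_closure (lreg p1 f).
Proof. by apply: subset_closure; exists f. Qed.

Lemma lreg_closure_approx (T : bop (lp p1 G)) e : lreg_closure T -> 0 < e ->
  exists f : l1 R G, exists A : {fset G},
    bop_norm (T - \sum_(a <- A) f a *: lreg p1 (l1_delta R a)) <= e.
Proof.
move=> /lreg_closureP TF e0; have e20 : 0 < e / 2 by rewrite divr_gt0.
have [f Tf] := TF _ e20; have [A fA] := l1_approx f e20.
exists f, A; rewrite -(subrK (lreg p1 f) T) -addrA (splitr e).
apply: (le_trans (bop_ler_normD (T - lreg p1 f) _)).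
apply: lerD; first exact: Tf.
apply: le_trans fA; rewrite -lecR -bop_normE -lp_normE.
have -> : \sum_(a <- A) f a *: lreg p1 (l1_delta R a) =
    lreg p1 (\sum_(a <- A) f a *: l1_delta R a).
  by rewrite [RHS]linear_sum; apply: eq_bigr => a _; rewrite linearZ.
rewrite -(linearB (@lreg R p p1 G)).
exact: lreg_norm.
Qed.

Lemma lreg_closure_submod :
  GRing.submod_closed [pred T : bop (lp p1 G) | `[< lreg_closure T >]].
Proof.
split=> [|c S T]; rewrite !inE/=.
  by rewrite -(linear0 (@lreg R p p1 G)); exact: lreg_closure_lreg.
move=> /lreg_closureP SF /lreg_closureP TF; apply/lreg_closureP => e e0.
have c0 : 0 < normc c + 1 by rewrite ltr_wpDl ?normc_ge0.
have [f Sf] := SF _ (divr_gt0 (divr_gt0 e0 (ltr0Sn R 1)) c0).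
have [g Tg] := TF _ (divr_gt0 e0 (ltr0Sn R 1)).
exists (c *: f + g); rewrite linearP opprD addrACA -scalerBr (splitr e).
apply: (le_trans (bop_ler_normD (c *: (S - lreg p1 f)) _)).
apply: lerD; last exact: Tg.
rewrite -lecR bop_normZ norm_normcE -rmorphM lecR.
rewrite ler_pdivlMr// in Sf; apply: le_trans Sf.
by rewrite mulrC ler_wpM2l ?bop_norm_ge0// lerDl.
Qed.

Lemma small_mul_bound (s t e : R) : 0 <= s -> 0 <= t -> 0 < e ->
  exists2 d, 0 < d & d * t + (s + d) * d <= e.
Proof.
move=> s0 t0 e0; have K0 : 0 < s + t + 1 by rewrite ltr_wpDl// addr_ge0.
exists (Num.min 1 (e / (s + t + 1))); first by rewrite lt_min ltr01 divr_gt0.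
have d1 : Num.min 1 (e / (s + t + 1)) <= 1 by rewrite ge_min lexx.
have dK : Num.min 1 (e / (s + t + 1)) <= e / (s + t + 1).
  by rewrite ge_min lexx orbT.
have : 0 <= Num.min 1 (e / (s + t + 1)).
  by rewrite le_min ler01 divr_ge0// ltW.
rewrite ler_pdivlMr// in dK; move: (Num.min _ _) d1 dK => d d1 dK d0.
by apply: le_trans dK; have := ler_piMr d0 d1; lra.
Qed.

Lemma lreg_closureM (S T : bop (lp p1 G)) :
  lreg_closure S -> lreg_closure T -> lreg_closure (S * T).
Proof.
move=> SF TF; apply/lreg_closureP => e e0.
have [d d0 de] := small_mul_bound (bop_norm_ge0 S) (bop_norm_ge0 T) e0.
have [f [A SA]] := lreg_closure_approx SF d0.
have [g [B TB]] := lreg_closure_approx TF d0.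
set U := \sum_(a <- A) _ in SA; set V := \sum_(a <- B) _ in TB.
exists (\sum_(a <- A) \sum_(b <- B) (f a * g b) *: l1_delta R (a * b)%g).
have <- : U * V = lreg p1 (\sum_(a <- A) \sum_(b <- B) (f a * g b) *: l1_delta R (a * b)%g).
  rewrite [RHS]linear_sum /U mulr_suml; apply: eq_bigr => a _.
  rewrite [RHS]linear_sum /V mulr_sumr; apply: eq_bigr => b _.
  by rewrite linearZ/= -lreg_deltaM -bop_scalerAl -bop_scalerAr scalerA.
exact: (le_trans (bop_norm_mulB (ltW d0) SA TB) de).
Qed.

Lemma lreg_closure_subring :
  GRing.subring_closed [pred T : bop (lp p1 G) | `[< lreg_closure T >]].
Proof.
have [F0 FZ] := lreg_closure_submod.
split=> [|S T SF TF|S T]; first by rewrite !inE/= -lreg_delta1; exact: lreg_closure_lreg.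
  by rewrite addrC -scaleN1r; exact: FZ.
by rewrite !inE/=; exact: lreg_closureM.
Qed.

End translations.

(* The algebra of p-pseudofunctions, as the norm closure of lambda_p(l^1(G)) in
   B(l^p(G)), with the operations and the norm of B(l^p(G)). *)
Record Flambda (R : realType) (p : R) (p1 : 1 <= p) (G : groupType) := MkFlambda {
  Flambda_val :> bop (lp p1 G);
  Flambda_valP : `[< lreg_closure Flambda_val >]
}.

Section Flambda_theory.
Context (R : realType) (p : R) (p1 : 1 <= p) (G : groupType).
Implicit Types S T : Flambda p1 G.

HB.instance Definition _ := [isSub for @Flambda_val R p p1 G].
HB.instance Definition _ := [Choice of Flambda p1 G by <:].
HB.instance Definition _ := GRing.SubChoice_isSubLmodule.Build R[i] (bop (lp p1 G))
  [pred T : bop (lp p1 G) | `[< lreg_closure T >]] (Flambda p1 G)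
  (@lreg_closure_submod R p p1 G).
HB.instance Definition _ := GRing.SubZmodule_isSubPzRing.Build (bop (lp p1 G))
  [pred T : bop (lp p1 G) | `[< lreg_closure T >]] (Flambda p1 G)
  (@lreg_closure_subring R p p1 G).

Lemma Flambda_oner_neq0 : (1 : Flambda p1 G) != 0.
Proof.
have p0 : 0 < p by exact: lt_le_trans p1.
have dfin : (lp_sum p (fun x : G => (x == 1%g)%:R : R[i]) < +oo)%E.
  apply/(lp_finiteP p1); exists 1 => // A; rewrite powR1.
  apply: (@le_trans _ _ (\sum_(x <- A | x == 1%g) 1)).
    rewrite [leRHS]big_mkcond/=; apply: ler_sum => x _.
    by case: eqP => _; rewrite ?normc1 ?powR1 ?normc0 ?powR0 ?gt_eqF.
  rewrite big_const_seq iter_addr_0 (count_uniq_mem _ (fset_uniq A)).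
  by case: (_ \in _).
apply/eqP => /(congr1 (fun T : Flambda p1 G => (T : bop (lp p1 G)) (Lp p1 dfin) 1%g)).
move=> T1; have : ((1%g == 1%g :> G)%:R : R[i]) = 0 := T1.
by move=> /eqP; rewrite eqxx oner_eq0.
Qed.

HB.instance Definition _ :=
  GRing.PzSemiRing_isNonZero.Build (Flambda p1 G) Flambda_oner_neq0.

Lemma Flambda_scalerAl (c : R[i]) S T : c *: (S * T) = (c *: S) * T.
Proof. by apply: val_inj; exact: bop_scalerAl. Qed.

Lemma Flambda_scalerAr (c : R[i]) S T : c *: (S * T) = S * (c *: T).
Proof. by apply: val_inj; exact: bop_scalerAr. Qed.

HB.instance Definition _ := GRing.LSemiModule_isLSemiAlgebra.Build R[i]
  (Flambda p1 G) Flambda_scalerAl.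
HB.instance Definition _ := GRing.LSemiAlgebra_isSemiAlgebra.Build R[i]
  (Flambda p1 G) Flambda_scalerAr.

Let nrm T : R[i] := `|Flambda_val T|.
Let nrmD S T : nrm (S + T) <= nrm S + nrm T.
Proof. exact: ler_normD. Qed.
Let nrmZ c T : nrm (c *: T) = `|c| * nrm T.
Proof. exact: normrZ. Qed.
Let nrm0 T : nrm T = 0 -> T = 0.
Proof. by move=> /normr0_eq0 T0; exact: val_inj. Qed.

HB.instance Definition _ := Lmodule_isNormed.Build R[i] (Flambda p1 G) nrmD nrmZ nrm0.

Lemma Flambda_normE T : `|T| = `|Flambda_val T|. Proof. by []. Qed.

Lemma Flambda_normM S T : `|S * T| <= `|S| * `|T|.
Proof. exact: bop_normM. Qed.

Definition Flambda_lreg (f : l1 R G) : Flambda p1 G :=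
  MkFlambda (asboolT (@lreg_closure_lreg R p p1 G f)).

End Flambda_theory.

(* Elements of C[G] are the finitely supported functions; they are identified
   with elements of the pseudofunction algebra via `Flambda_lreg` and
   `l1_of_fsfun`. *)
Notation group_algebra R G := {fsfun G -> R[i] with 0}.

Section group_algebra_map.
Context (R : realType) (H G : groupType) (phi : H -> G).
Local Open Scope fset_scope.

(* The map C[H] -> C[G] sending the basis element h to the basis element
   phi h. *)
Definition galg_map (f : group_algebra R H) : group_algebra R G :=
  [fsfun g in [fset phi h | h in finsupp f] =>
     \sum_(h <- finsupp f | phi h == g) f h].

Lemma galg_mapE (f : group_algebra R H) g :
  galg_map f g = \sum_(h <- finsupp f | phi h == g) f h.
Proof.
rewrite fsfunE; case: ifPn => // gN; rewrite big_seq_cond big1// => h /andP[hf /eqP hg].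
by case/negP: gN; apply/imfsetP; exists h.
Qed.

End group_algebra_map.

(* Main.v *)
Require Import Defs.
From HB Require Import structures.
From mathcomp Require Import all_boot all_order all_algebra finmap.
From mathcomp Require Import all_classical all_reals all_analysis complex.
Set Implicit Arguments.
Unset Strict Implicit.
Unset Printing Implicit Defensive.
Import Order.TTheory GRing.Theory Num.Theory numFieldNormedType.Exports.
Local Open Scope classical_set_scope.
Local Open Scope ring_scope.

(** The right cosets of H partition G; after choosing a representative r of each
  coset, l^p(G) becomes the l^p-direct sum of the spaces l^p(H r), each a copy of
  l^p(H).  Letting an operator T on l^p(H) act on every summand gives an operator
  on l^p(G) of the same norm, and T |-> T (+) T (+) ... is a unital algebra
  homomorphism.  Since left translation by h in H preserves right cosets, it
  sends lambda_p(delta_h) on l^p(H) to lambda_p(delta_h) on l^p(G), hence maps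
  F^p_lambda(H) into F^p_lambda(G). *)

(** * Right cosets of H and canonical representatives *)

Section right_cosets.
Context (G : groupType) (S : {pred G}) (H : subGroupType S).
Implicit Types (g x : G) (h k : H).
Local Open Scope group_scope.

Lemma sub_val1 : \val (1 : H) = 1.
Proof. exact: gmulf1. Qed.

Lemma sub_valM h k : \val (h * k) = \val h * \val k.
Proof. exact: gmulfM. Qed.

Lemma sub_valV h : \val h^-1 = (\val h)^-1.
Proof. exact: gmulfV. Qed.

Lemma sub_mem h : \val h \in S.
Proof. exact: valP. Qed.

(** The value of [choose] depends only on the extension of the predicate, not on the seed satisfying
    it, so this is constant on each right coset. *)
Definition coset_rep x : G := choose (fun y => x * y^-1 \in S) x.

(** The default 1 is never reached: [chooseP] puts the quotient in [S], see [coset_decomp]. *)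
Definition coset_part x : H := insubd 1 (x * (coset_rep x)^-1).

Lemma mem_div_refl x : x * x^-1 \in S.
Proof. by rewrite mulgV -sub_val1 sub_mem. Qed.

Lemma coset_decomp x : \val (coset_part x) * coset_rep x = x.
Proof.
have xS : x * (coset_rep x)^-1 \in S.
  by apply: (@chooseP _ (fun y => x * y^-1 \in S)); exact: mem_div_refl.
by rewrite /coset_part insubdK// mulgVK.
Qed.

(** [S] is a bare predicate; its closure properties are obtained by lifting elements to [H],
    multiplying there and projecting back. *)
Lemma mem_mull h x : (\val h * x \in S) = (x \in S).
Proof.
apply/idP/idP => xS.
  have := sub_mem (h^-1 * insubd 1 (\val h * x)).
  by rewrite sub_valM sub_valV insubdK// mulKg.
by have := sub_mem (h * insubd 1 x); rewrite sub_valM insubdK.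
Qed.

Lemma coset_repM h x : coset_rep (\val h * x) = coset_rep x.
Proof.
rewrite /coset_rep (@eq_choose _ _ (fun y => x * y^-1 \in S)); last first.
  by move=> y; rewrite -mulgA mem_mull.
apply: choose_id; last exact: mem_div_refl.
by rewrite invgM mulgA mulgV mul1g -sub_valV sub_mem.
Qed.

Lemma coset_partM h x : coset_part (\val h * x) = h * coset_part x.
Proof.
apply: val_inj; apply: (mulIg (coset_rep x)).
by rewrite -{1}(coset_repM h x) coset_decomp sub_valM -mulgA coset_decomp.
Qed.

Lemma coset_repK x : coset_rep (coset_rep x) = coset_rep x.
Proof. by rewrite -{2}(coset_decomp x) coset_repM. Qed.

Lemma coset_part_rep x : coset_part (coset_rep x) = 1.
Proof.
apply: val_inj; apply: (mulIg (coset_rep x)).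
by rewrite -{2}coset_repK coset_decomp sub_val1 mul1g.
Qed.

Lemma coset_eq x y :
  coset_rep x = coset_rep y -> coset_part x = coset_part y -> x = y.
Proof. by move=> rE pE; rewrite -(coset_decomp x) -(coset_decomp y) rE pE. Qed.

End right_cosets.

Arguments coset_repK {G S}.

(** * Real-valued forms of the norm identities *)

Section lp_norms.
Context (R : realType) (p : R) (p1 : 1 <= p) (X : choiceType).

Lemma lp_norm_powR (f : lp p1 X) : ((lp_norm f `^ p)%:E = lp_sum p f)%E.
Proof.
have p_gt0 : 0 < p by exact: lt_le_trans p1.
have f0 := lp_sum_ge0 p f.
rewrite /lp_norm -powRrM mulVf ?gt_eqF// powRr1 ?fine_ge0// fineK//.
by rewrite ge0_fin_numE// lp_finite.
Qed.

Lemma bop_norm_lp (T : bop (lp p1 X)) f :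
  lp_norm (T f) <= bop_norm T * lp_norm f.
Proof. by have := bop_norm_ub T f; rewrite !lp_normE -rmorphM lecR. Qed.

End lp_norms.

(** * Amplification of operators from l^p(H) to l^p(G) *)

Section amplification.
Context (R : realType) (p : R) (p1 : 1 <= p).
Context (G : groupType) (S : {pred G}) (H : subGroupType S).
Implicit Types (x g : G) (h : H) (xi : lp p1 G) (eta : lp p1 H).
Implicit Types T U : bop (lp p1 H).

Let p_gt0 : 0 < p. Proof. exact: lt_le_trans p1. Qed.

Local Notation rep := (@coset_rep G S).
Local Notation part := (@coset_part G S H).

Lemma slice_bound xi g :
  lp_bound p (fun h => xi (\val h * g)%g) (lp_norm xi).
Proof.
move=> A; apply: le_trans (lp_norm_bound xi [fset (\val h * g)%g | h in A]%fset).
by rewrite big_imfset//= => h k _ _ /mulIg /val_inj.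
Qed.

Lemma slice_finite xi g : (lp_sum p (fun h => xi (\val h * g)%g) < +oo)%E.
Proof.
apply/(lp_finiteP p1).
by exists (lp_norm xi); [exact: lp_norm_ge0|exact: slice_bound].
Qed.

(** The restriction of [xi] to the coset H g, transported to H by taking [g] as base point. *)
Definition slice xi g : lp p1 H := Lp p1 (slice_finite xi g).

Lemma sliceE xi g h : slice xi g h = xi (\val h * g)%g. Proof. by []. Qed.

Lemma slice_norm xi g : lp_norm (slice xi g) <= lp_norm xi.
Proof. by apply/lp_norm_leP; [exact: lp_norm_ge0|exact: slice_bound]. Qed.

Lemma slice_linear g : linear (slice ^~ g).
Proof. by move=> a xi eta; exact: lp_ext. Qed.

(** Distinct representatives have disjoint cosets, so the slices occupy disjoint parts of [xi]. *)
Lemma sum_slice_norm xi (B : {fset G}) : {in B, forall x, rep x = x} ->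
  \sum_(g <- B) lp_norm (slice xi g) `^ p <= lp_norm xi `^ p.
Proof.
move=> Brep; rewrite -lee_fin -sumEFin.
under eq_bigr do rewrite lp_norm_powR.
(* Exchanging the two sums reduces the claim to finite subsets [A] of H. *)
rewrite -esum_sum; last by move=> h g _ _; rewrite lee_fin powR_ge0.
under eq_esum do rewrite sumEFin.
apply/esum_le_finP => [h|A]; first by apply: sumr_ge0 => g _; exact: powR_ge0.
apply: le_trans (lp_norm_bound xi [fset (\val h * g)%g | h in A, g in B]%fset).
rewrite big_imfset2/=; last first.
  (* Injectivity of the product on [A] and [B]: [coset_rep] recovers [g], then cancellation recovers
     [h]. *)
  move=> [h g] [k g'] /= /andP[_ /Brep/= gE] /andP[_ /Brep/= gE'] e.
  have gg : g = g' by rewrite -gE -gE' -(coset_repM h) e coset_repM.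
  by move: e; rewrite gg => /mulIg /val_inj ->.
by [].
Qed.

Definition amp_fun T xi : G -> R[i] := fun x => T (slice xi (rep x)) (part x).


(** A finite sum splits by coset; on each coset the norm of T bounds it by a slice norm, and
    [sum_slice_norm] adds these up. *)
Lemma amp_bound T xi : lp_bound p (amp_fun T xi) (bop_norm T * lp_norm xi).
Proof.
move=> A; rewrite (partition_big_imfset _ rep)/=.
apply: (@le_trans _ _ (\sum_(g <- [fset rep x | x in A]%fset)
    bop_norm T `^ p * lp_norm (slice xi g) `^ p)).
  rewrite big_seq [leRHS]big_seq; apply: ler_sum => g _.
  rewrite -powRM ?bop_norm_ge0 ?lp_norm_ge0//.
  have := proj1 (lp_norm_leP _ (mulr_ge0 (bop_norm_ge0 T) (lp_norm_ge0 _)))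
    (bop_norm_lp T (slice xi g)).
  (* On the points of [A] in a single coset [part] is injective, so they form a finite subset of
     H. *)
  move=> /(_ [fset part x | x in [fset x in A | rep x == g]]%fset).
  apply: le_trans; rewrite big_imfset/=; last first.
    move=> x y; rewrite !inE/= => /andP[_ /eqP xg] /andP[_ /eqP yg].
    by apply: coset_eq; rewrite xg yg.
  rewrite big_fset/= le_eqVlt; apply/orP; left; apply/eqP.
  by apply: eq_bigr => x /eqP xg; rewrite /amp_fun xg.
rewrite -mulr_sumr powRM ?bop_norm_ge0 ?lp_norm_ge0//.
rewrite ler_wpM2l ?powR_ge0// sum_slice_norm// => _ /imfsetP[x _ ->].
exact: coset_repK.
Qed.

Lemma amp_finite T xi : (lp_sum p (amp_fun T xi) < +oo)%E.
Proof.
apply/(lp_finiteP p1); exists (bop_norm T * lp_norm xi); last exact: amp_bound.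
by rewrite mulr_ge0 ?bop_norm_ge0 ?lp_norm_ge0.
Qed.

Definition amp_op T xi : lp p1 G := Lp p1 (amp_finite T xi).

Lemma amp_op_norm T xi : `|amp_op T xi| <= (bop_norm T)%:C%C * `|xi|.
Proof.
rewrite !lp_normE -rmorphM lecR; apply/lp_norm_leP; last exact: amp_bound.
by rewrite mulr_ge0 ?bop_norm_ge0 ?lp_norm_ge0.
Qed.

Lemma amp_bounded T : `[< bounded_linear (amp_op T) >].
Proof.
apply/asboolP; split; last first.
  by exists (bop_norm T)%:C%C => xi; exact: amp_op_norm.
move=> a xi xi'; apply: lp_ext => x.
by rewrite lp_addE lp_scaleE /= /amp_fun slice_linear linearP.
Qed.

Definition amp T : bop (lp p1 G) := Bop (amp_bounded T).

Lemma ampE T xi x : amp T xi x = T (slice xi (rep x)) (part x).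
Proof. by []. Qed.

(** Each slice at a representative is acted on by T alone; multiplicativity and the lower norm bound
    both rest on this. *)
Lemma slice_amp T xi g : slice (amp T xi) (rep g) = T (slice xi (rep g)).
Proof.
apply: lp_ext => h.
rewrite sliceE ampE coset_repM (coset_repK H).
by rewrite coset_partM coset_part_rep mulg1.
Qed.

Lemma amp_linear : linear amp.
Proof.
move=> a T U; apply: bop_ext => xi; apply: lp_ext => x.
rewrite bop_addE bop_scaleE lp_addE lp_scaleE !ampE.
by rewrite bop_addE bop_scaleE lp_addE lp_scaleE.
Qed.

Lemma amp1 : amp 1 = 1.
Proof.
apply: bop_ext => xi; apply: lp_ext => x.
by rewrite ampE !bop_oneE sliceE coset_decomp.
Qed.

Lemma ampM T U : amp (T * U) = amp T * amp U.
Proof.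
apply: bop_ext => xi; apply: lp_ext => x.
by rewrite bop_mulE !ampE slice_amp bop_mulE.
Qed.

(** Extension by zero from the coset H itself, whose base point [rep 1] may differ from 1; hence
    [eta] is read through [part]. *)
Definition coset_ext_fun eta : G -> R[i] :=
  fun x => if rep x == rep 1%g then eta (part x) else 0.

Lemma coset_ext_bound eta : lp_bound p (coset_ext_fun eta) (lp_norm eta).
Proof.
move=> A.
pose B := [fset x in A | rep x == rep 1%g]%fset.
apply: le_trans (lp_norm_bound eta [fset part x | x in B]%fset).
rewrite big_imfset/=; last first.
  move=> x y; rewrite !inE/= => /andP[_ /eqP xg] /andP[_ /eqP yg].
  by apply: coset_eq; rewrite xg yg.
rewrite big_fset/= [leRHS]big_mkcond/=; apply: ler_sum => x _.
by rewrite /coset_ext_fun; case: ifP => // _; rewrite Normc.normc0 powR0 ?gt_eqF.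
Qed.

Lemma coset_ext_finite eta : (lp_sum p (coset_ext_fun eta) < +oo)%E.
Proof.
apply/(lp_finiteP p1).
by exists (lp_norm eta); [exact: lp_norm_ge0|exact: coset_ext_bound].
Qed.

Definition coset_ext eta : lp p1 G := Lp p1 (coset_ext_finite eta).

Lemma coset_ext_norm eta : lp_norm (coset_ext eta) <= lp_norm eta.
Proof. by apply/lp_norm_leP; [exact: lp_norm_ge0|exact: coset_ext_bound]. Qed.

Lemma slice_coset_ext eta : slice (coset_ext eta) (rep 1%g) = eta.
Proof.
apply: lp_ext => h; rewrite sliceE /= /coset_ext_fun.
by rewrite coset_repM (coset_repK H) eqxx coset_partM coset_part_rep mulg1.
Qed.

(** For the lower bound, [T eta] is a slice of [amp T] applied to the extension of [eta], and
    neither slicing nor extending increases the norm. *)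
Lemma amp_bop_norm T : bop_norm (amp T) = bop_norm T.
Proof.
apply/eqP; rewrite eq_le; apply/andP; split.
  by apply: bop_norm_le; [exact: bop_norm_ge0|exact: amp_op_norm].
apply: bop_norm_le => [|eta]; first exact: bop_norm_ge0.
rewrite !lp_normE -rmorphM lecR -{1}(slice_coset_ext eta) -slice_amp.
apply: le_trans (slice_norm _ _) _.
apply: le_trans (bop_norm_lp _ _) _; rewrite ler_wpM2l ?bop_norm_ge0//.
exact: coset_ext_norm.
Qed.

Lemma amp_delta h :
  amp (lreg p1 (l1_delta R h)) = lreg p1 (l1_delta R (\val h : G)).
Proof.
apply: bop_ext => xi; apply: lp_ext => x.
by rewrite ampE !lreg_deltaE sliceE sub_valM sub_valV -mulgA coset_decomp.
Qed.

HB.instance Definition _ := GRing.isLinear.Build R[i] (bop (lp p1 H))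
  (bop (lp p1 G)) *:%R amp amp_linear.

Lemma amp_sum_delta (A : {fset H}) (c : H -> R[i]) :
  amp (\sum_(a <- A) c a *: lreg p1 (l1_delta R a)) =
  lreg p1 (\sum_(a <- A) c a *: l1_delta R (\val a : G)).
Proof.
rewrite !linear_sum; apply: eq_bigr => a _.
by rewrite !linearZ/= amp_delta.
Qed.

(** T is approximated by finite combinations of translations, whose images are known from
    [amp_delta]; the isometry [amp] preserves the error. *)
Lemma amp_closure T : lreg_closure T -> lreg_closure (amp T).
Proof.
move=> TF; apply/lreg_closureP => e e0.
have [f [A TA]] := lreg_closure_approx TF e0.
exists (\sum_(a <- A) f a *: l1_delta R (\val a : G)).
by rewrite -amp_sum_delta -linearB amp_bop_norm.
Qed.

End amplification.

(** * Finitely supported functions as sums of point masses *)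

Section group_algebra.
Context (R : realType) (G : groupType).

(** A general [phi] serves both [galg_map] and, with [phi] the identity, the expansion of a single
    function. *)
Lemma l1_sum_deltaE (H : groupType) (phi : H -> G) (A : {fset H})
    (c : H -> R[i]) x :
  (\sum_(a <- A) c a *: l1_delta R (phi a)) x = \sum_(a <- A | phi a == x) c a.
Proof.
rewrite [RHS]big_mkcond/=; elim/big_rec2: _ => [//|a y w _ wy].
rewrite lp_addE lp_scaleE l1_deltaE wy eq_sym.
by case: eqP => _; rewrite ?mulr1// mulr0.
Qed.

Lemma galg_map_sum_delta (H : groupType) (phi : H -> G) (f : group_algebra R H) :
  l1_of_fsfun (galg_map phi f) =
  \sum_(a <- finsupp f) f a *: l1_delta R (phi a).
Proof. by apply: lp_ext => x; rewrite l1_sum_deltaE /= galg_mapE. Qed.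

Lemma l1_of_fsfun_sum_delta (f : group_algebra R G) :
  l1_of_fsfun f = \sum_(a <- finsupp f) f a *: l1_delta R a.
Proof.
apply: lp_ext => x; rewrite (l1_sum_deltaE id)/=.
have [xf|xf] := boolP (x \in finsupp f).
  by rewrite -big_filter filter_pred1_uniq ?fset_uniq// big_seq1.
rewrite fsfun_dflt// big_seq_cond big1// => a /andP[af /eqP ax].
by rewrite -ax af in xf.
Qed.

End group_algebra.

(** * The induced homomorphism of pseudofunction algebras *)

Section Flambda_amplification.
Context (R : realType) (p : R) (p1 : 1 <= p).
Context (G : groupType) (S : {pred G}) (H : subGroupType S).

Definition Flambda_amp (T : Flambda p1 H) : Flambda p1 G :=
  MkFlambda (asboolT (amp_closure (asboolW (Flambda_valP T)))).

Lemma Flambda_amp_linear : linear Flambda_amp.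
Proof. by move=> a T U; apply: val_inj; exact: amp_linear. Qed.

Lemma Flambda_amp_monoid_morphism : monoid_morphism Flambda_amp.
Proof.
by split=> [|T U]; apply: val_inj; [exact: amp1|exact: ampM].
Qed.

HB.instance Definition _ := GRing.isLinear.Build R[i] (Flambda p1 H)
  (Flambda p1 G) *:%R Flambda_amp Flambda_amp_linear.
HB.instance Definition _ := GRing.isMonoidMorphism.Build (Flambda p1 H)
  (Flambda p1 G) Flambda_amp Flambda_amp_monoid_morphism.

End Flambda_amplification.

Theorem proposition2p3 (R : realType) (p : R) (p1 : 1 <= p)
    (G : groupType) (Gcount : countable [set: G])
    (S : {pred G}) (H : subGroupType S) :
  exists Phi : {lrmorphism Flambda p1 H -> Flambda p1 G},
    (forall a : Flambda p1 H, `|Phi a| = `|a|) /\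
    (forall f : group_algebra R H,
       Phi (Flambda_lreg p1 (l1_of_fsfun f)) =
       Flambda_lreg p1 (l1_of_fsfun (galg_map (\val : H -> G) f))).
Proof.
exists (@Flambda_amp R p p1 G S H); split=> [a|f].
  by rewrite !Flambda_normE !bop_normE amp_bop_norm.
(* Both sides become sums over [finsupp f], matched by the action of [amp] on translations. *)
apply: val_inj; rewrite /= galg_map_sum_delta -amp_sum_delta.
by rewrite l1_of_fsfun_sum_delta linear_sum; under eq_bigr do rewrite linearZ.
Qed.
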